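(* Let $X$ be a real Hilbert space, let $\gamma>0$, let $x_0,y_0\in X$, and let $C_\gamma=\{(x,y)\in X\times X : \langle x,y\rangle=\gamma\}$. Then the following hold. (i) When $x_0\neq y_0$ and $x_0\neq -y_0$, the projection is a singleton: $$P_{C_\gamma}(x_0,y_0)=\left\{\left(\frac{x_0-\lambda y_0}{1-\lambda^2},\ \frac{y_0-\lambda x_0}{1-\lambda^2}\right)\right\},$$ where $\lambda$ is the unique solution of $H(\lambda)=0$ in the open interval $(-1,1)$, with $$H(\lambda)=\frac{(\lambda^2+1)p-2\lambda q}{2(1-\lambda^2)^2}-\gamma,\qquad p=2\langle x_0,y_0\rangle,\qquad q=\|x_0\|^2+\|y_0\|^2.$$ (ii) When $x_0=-y_0$, the projection is the set $$P_{C_\gamma}(x_0,-x_0)=\left\{\left(\frac{x_0}{2}+\frac{\tilde u}{\sqrt2},\ -\frac{x_0}{2}+\frac{\tilde u}{\sqrt2}\right) : \tilde u\in X,\ \|\tilde u\|^2=2\gamma+\frac{\|x_0\|^2}{2}\right\}.$$ (iii) a) When $x_0=y_0$ and $\|x_0\|\ge 2\sqrt{\gamma}$, the projection is the set $$P_{C_\gamma}(x_0,x_0)=\left\{\left(\frac{x_0}{2}-\frac{\tilde v}{\sqrt2},\ \frac{x_0}{2}+\frac{\tilde v}{\sqrt2}\right) : \tilde v\in X,\ \|\tilde v\|^2=\frac{\|x_0\|^2}{2}-2\gamma\right\}.$$ b) When $x_0=y_0$ and $0<\|x_0\|<2\sqrt{\gamma}$, the projection is the singleton $$P_{C_\gamma}(x_0,x_0)=\left\{\sqrt{\gamma}\left(\frac{x_0}{\|x_0\|},\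 \frac{x_0}{\|x_0\|}\right)\right\}.$$
   Context: $X$ is a real Hilbert space with inner product $\langle\cdot,\cdot\rangle$ and induced norm $\|\cdot\|$. The product $X\times X$ carries the norm $\|(x,y)\|^2=\|x\|^2+\|y\|^2$. For a set $S\subseteq X\times X$ and a point $z\in X\times X$, $P_S(z)$ denotes the (possibly empty, possibly multi-valued) set of nearest points: $P_S(z)=\{s\in S : \|z-s\|\le\|z-s'\|\text{ for all }s'\in S\}$. *)

(* Defs.v *)
From HB Require Import structures.
From mathcomp Require Import all_boot all_order all_algebra.
From mathcomp Require Import sesquilinear.
From mathcomp Require Import boolp classical_sets reals topology normedtype.

Set Implicit Arguments.
Unset Strict Implicit.
Unset Printing Implicit Defensive.
Import Order.TTheory GRing.Theory Num.Theory.
Import numFieldNormedType.Exports.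
Local Open Scope classical_set_scope.
Local Open Scope ring_scope.

(* A real Hilbert space is a complete normed module over a realType whose norm
   is induced by a symmetric positive definite bilinear form. *)
Definition induces_norm (R : realType) (X : normedModType R)
  (ip : {dot X for idfun}) : Prop :=
  forall x : X, `|x| = Num.sqrt (ip x x).

(* The canonical norm of the product type X * X is the max norm, hence this
   separate Hilbert norm. *)
Definition prod_norm (R : realType) (X : normedModType R) (z : X * X) : R :=
  Num.sqrt (`|z.1| ^+ 2 + `|z.2| ^+ 2).

Definition proj (R : realType) (X : normedModType R)
  (S : set (X * X)) (z : X * X) : set (X * X) :=
  [set s | S s /\ forall s', S s' -> prod_norm (z - s) <= prod_norm (z - s')].

Definition C_ (R : realType) (X : normedModType R)
  (ip : {dot X for idfun}) (gamma : R) : set (X * X) :=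
  [set z | ip z.1 z.2 = gamma].

Definition H (R : realType) (gamma p q lambda : R) : R :=
  ((lambda ^+ 2 + 1) * p - 2 * lambda * q) / (2 * (1 - lambda ^+ 2) ^+ 2)
    - gamma.

(* Main.v *)
Require Import Defs.
From HB Require Import structures.
From mathcomp Require Import all_boot all_order all_algebra.
From mathcomp Require Import sesquilinear.
From mathcomp Require Import boolp classical_sets reals topology normedtype.
From mathcomp Require Import ring lra.

Set Implicit Arguments.
Unset Strict Implicit.
Unset Printing Implicit Defensive.
Import Order.TTheory GRing.Theory Num.Theory.
Import numFieldNormedType.Exports.
Local Open Scope classical_set_scope.
Local Open Scope ring_scope.

(** Projecting onto the hyperboloid [<x, y> = gamma] minimises a quadratic
function under one quadratic constraint, so the method is that of Lagrange
multipliers; the point is that here the multiplier certifies a global minimum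
although the constraint set is not convex.

Suppose [(a, b)] lies on the hyperboloid and [(x0, y0) = (a + l b, b + l a)],
which says that [(a, b)] is a critical point with multiplier [l].  For any
other point [(x, y)] of the hyperboloid, the excess of its squared distance to
[(x0, y0)] over that of [(a, b)] is exactly the value at
[(h, k) = (x - a, y - b)] of the form
[|h|^2 + |k|^2 + 2 l <h, k>
 = (1 + l)/2 |h + k|^2 + (1 - l)/2 |h - k|^2]
([sqr_dist_gap], [lagrange_formE]): the terms linear in [(h, k)] are
eliminated by the constraint.  The form is nonnegative when [|l| <= 1], so
[(a, b)] is then a nearest point, and all nearest points are obtained by adding
to [(a, b)] zeros of the form that keep it on the hyperboloid
([proj_critical]).

If [|l| < 1] the form is definite and the projection is a single point.
Solving [a + l b = x0], [b + l a = y0] for [(a, b)] turns the constraint into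
[H l = 0] ([ip_criticalE]).  When [x0 <> y0] and [x0 <> - y0] one has
[|p| < q], and the intermediate value theorem gives a root in [(-1, 1)]
([exists_H_root]).  Uniqueness of the root comes from geometry: two roots give
two descriptions of the one nearest point, and the multiplier can be read off
from that point.  The definite case also covers [x0 = y0] with small norm, where
[a = b] and [l = |x0| / sqrt gamma - 1].

If [l] is [e = 1] or [e = -1], the zeros of the form are the pairs with
[h + e k = 0].  This multiplier occurs when [y0 = e x0], and the projection is
the part of the hyperboloid in the affine subspace [x + e y = x0]
([proj_diagonal]).  On that subspace the constraint fixes the norm of the free
component, hence the spheres of the remaining two cases
([proj_diagonal_sphere]). *)

(** * The scalar equation for the multiplier *)

(** After multiplication by [2 (1 - l ^ 2) ^ 2] the equation [H l = 0] is
polynomial, and at [l = -1] and [l = 1] only the terms [2 (p + q)] and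
[2 (p - q)] survive, of opposite signs. *)
Lemma exists_H_root (R : realType) (gamma p q : R) : `|p| < q ->
  exists l : R, -1 < l < 1 /\ H gamma p q l = 0.
Proof.
rewrite ltr_norml => /andP[pNq pq].
pose g : {poly R} := (4 * gamma)%:P * (1 - 'X ^+ 2) ^+ 2
  - 2 * (p%:P * ('X ^+ 2 + 1) - 2 * q%:P * 'X).
have gE l : g.[l] = 4 * gamma * (1 - l ^+ 2) ^+ 2
    - 2 * (p * (l ^+ 2 + 1) - 2 * q * l).
  by rewrite /g !hornerE.
have [||l] := @poly_ivt _ g (-1) 1; first by lra.
  by rewrite !gE; apply/andP; split; nra.
move=> /andP[l0 l1] /rootP; rewrite gE => gl0.
have lN1 : l != -1 by apply/eqP => e; rewrite e in gl0; nra.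
have lN : l != 1 by apply/eqP => e; rewrite e in gl0; nra.
have lt1 : -1 < l < 1 by rewrite !lt_neqAle eq_sym lN1 lN l0.
exists l; split=> //.
have nz : 1 - l ^+ 2 != 0 by rewrite gt_eqF //; nra.
rewrite /H; apply/eqP; rewrite subr_eq0; apply/eqP.
apply: (canLR (mulfK _)); first by rewrite mulf_neq0 ?expf_neq0 ?pnatr_eq0.
by nra.
Qed.

(** * The inner product *)

Section InnerProduct.
Variables (R : realType) (X : normedModType R) (ip : {dot X for idfun}).
Hypothesis ip_norm : induces_norm ip.

Lemma ipC x y : ip x y = ip y x.
Proof. by rewrite hermC expr0 mul1r. Qed.

Lemma ipDl x y z : ip (x + y) z = ip x z + ip y z.
Proof. exact: linearDl. Qed.

Lemma ipDr x y z : ip z (x + y) = ip z x + ip z y.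
Proof. exact: linearDr. Qed.

Lemma ipNl x y : ip (- x) y = - ip x y.
Proof. exact: linearNl. Qed.

Lemma ipNr x y : ip x (- y) = - ip x y.
Proof. exact: linearNr. Qed.

Lemma ipZl a x y : ip (a *: x) y = a * ip x y.
Proof. exact: linearZl_LR. Qed.

Lemma ipZr a x y : ip x (a *: y) = a * ip x y.
Proof. exact: linearZr_LR. Qed.

Definition ip_linE := (ipDl, ipDr, ipNl, ipNr, ipZl, ipZr).

Lemma ip_ge0 x : 0 <= ip x x.
Proof.
have [->|x0] := eqVneq x 0; first by rewrite (linear0l ip).
by have := normr_gt0 x; rewrite x0 ip_norm sqrtr_gt0 => /ltW.
Qed.

Lemma normE x : `|x| ^+ 2 = ip x x.
Proof. by rewrite ip_norm sqr_sqrtr // ip_ge0. Qed.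

Lemma ip_eq0 x : ip x x = 0 -> x = 0.
Proof. by rewrite -normE => /eqP; rewrite sqrf_eq0 normr_eq0 => /eqP. Qed.

(** * Critical points and nearest points *)

(** The quadratic part of the Lagrangian of the projection problem at
multiplier [l]. *)
Definition lagrange_form l (z : X * X) : R :=
  ip z.1 z.1 + ip z.2 z.2 + 2 * l * ip z.1 z.2.

(** Diagonalisation of the form in the coordinates [z.1 + z.2], [z.1 - z.2]; it
shows that the sign is governed by [|l| <= 1]. *)
Lemma lagrange_formE l z : lagrange_form l z =
  (1 + l) / 2 * ip (z.1 + z.2) (z.1 + z.2)
  + (1 - l) / 2 * ip (z.1 - z.2) (z.1 - z.2).
Proof. by rewrite /lagrange_form !ip_linE (ipC z.2 z.1); field. Qed.

Lemma lagrange_form_ge0 (l : R) z : -1 <= l <= 1 -> 0 <= lagrange_form l z.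
Proof.
move=> l1; rewrite lagrange_formE.
by apply: addr_ge0; apply: mulr_ge0; rewrite ?ip_ge0 //; lra.
Qed.

Lemma lagrange_form_eq0 (l : R) z : -1 < l < 1 -> lagrange_form l z = 0 -> z = 0.
Proof.
case: z => h k l1; rewrite lagrange_formE /=.
have Ds := ip_ge0 (h + k); have Dd := ip_ge0 (h - k) => Q0.
have /ip_eq0 s : ip (h + k) (h + k) = 0 by nra.
have /ip_eq0/eqP : ip (h - k) (h - k) = 0 by nra.
rewrite subr_eq0 => /eqP d; move: s; rewrite d => /eqP.
by rewrite -mulr2n -scaler_nat scaler_eq0 pnatr_eq0 /= => /eqP ->.
Qed.

(** The increment [(h, k)] from [(a, b)] to [(x, y)] enters the difference of
squared distances linearly only through [- 2 l (<h, b> + <a, k>)], and the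
constraint [<x, y> = <a, b>] makes this equal to [2 l <h, k>]. *)
Lemma sqr_dist_gap l a b x y : ip x y = ip a b ->
  let z0 := (a + l *: b, b + l *: a) in
  prod_norm (z0 - (x, y)) ^+ 2 =
  prod_norm (z0 - (a, b)) ^+ 2 + lagrange_form l ((x, y) - (a, b)).
Proof.
move=> C z0; rewrite /prod_norm !sqr_sqrtr ?addr_ge0 ?sqr_ge0 // !normE.
rewrite /lagrange_form /= !ip_linE !(ipC b) !(ipC y) (ipC x a) -C.
ring: C.
Qed.

(** The gap in [sqr_dist_gap] does not involve the distance itself, so a
multiplier in [[-1, 1]] certifies that [(a, b)] is globally nearest, and the
ties are exactly the zeros of the form. *)
Lemma proj_critical gamma (l : R) a b : -1 <= l <= 1 -> ip a b = gamma ->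
  proj (C_ ip gamma) (a + l *: b, b + l *: a) =
  [set z | C_ ip gamma z /\ lagrange_form l (z - (a, b)) = 0].
Proof.
move=> l1 ab; set z0 := (a + _, _).
have gap z : C_ ip gamma z -> prod_norm (z0 - z) ^+ 2 =
    prod_norm (z0 - (a, b)) ^+ 2 + lagrange_form l (z - (a, b)).
  by case: z => x y Cz; apply: sqr_dist_gap; rewrite ab.
have leE (u v : X * X) : (prod_norm u <= prod_norm v) =
    (prod_norm u ^+ 2 <= prod_norm v ^+ 2).
  by rewrite ler_sqr // nnegrE sqrtr_ge0.
apply/seteqP; split=> z [Cz].
  move=> /(_ (a, b) ab); rewrite leE gap // gerDl => le0; split=> //.
  by apply/eqP; rewrite eq_le le0 lagrange_form_ge0.
move=> Q0; split=> // z' Cz'; rewrite leE (gap z) // (gap z') // Q0.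
by rewrite addr0 lerDl lagrange_form_ge0.
Qed.

Lemma proj_critical_lt1 gamma (l : R) a b : -1 < l < 1 -> ip a b = gamma ->
  proj (C_ ip gamma) (a + l *: b, b + l *: a) = [set (a, b)].
Proof.
move=> l1 ab; rewrite proj_critical //; last by lra.
apply/seteqP; split=> z /=.
  by move=> [_ /(lagrange_form_eq0 l1)/eqP]; rewrite subr_eq0 => /eqP.
move=> ->; split=> //; rewrite subrr /lagrange_form /=.
by rewrite (linear0l ip) mulr0 !addr0.
Qed.

(** At [l = e] with [e = 1] or [e = -1] the form is [|z.1 + e z.2|^2], hence its
zeros form a subspace instead of a point. *)
Lemma proj_diagonal gamma (e : R) a b : e = 1 \/ e = -1 -> ip a b = gamma ->
  proj (C_ ip gamma) (a + e *: b, e *: (a + e *: b)) =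
  [set z | C_ ip gamma z /\ z.1 + e *: z.2 = a + e *: b].
Proof.
move=> e1 ab; have ee : e * e = 1 by case: e1 => ->; ring.
have -> : e *: (a + e *: b) = b + e *: a.
  by rewrite scalerDr scalerA ee scale1r addrC.
rewrite proj_critical //; last by case: e1 => ->; lra.
have QE z : lagrange_form e z = ip (z.1 + e *: z.2) (z.1 + e *: z.2).
  by rewrite /lagrange_form !ip_linE (ipC z.2 z.1); ring: ee.
have sub z : (z - (a, b)).1 + e *: (z - (a, b)).2
    = (z.1 + e *: z.2) - (a + e *: b).
  by rewrite /= scalerBr opprD addrACA.
apply/seteqP; split=> z /= [Cz]; rewrite QE sub => h; split=> //.
  by apply/eqP; rewrite -subr_eq0; apply/eqP/ip_eq0.
by rewrite h subrr (linear0l ip).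
Qed.

(** * Projecting points of the two diagonals *)

(** The points with [a + e b = w] are the [P u] of the proof, and
[<a, b> = e (|w|^2 / 2 - |u|^2) / 2] along them, which gives the sphere.  The
hypothesis provides a base point for [proj_diagonal]; asking for it only when
the hyperboloid is nonempty makes the statement true in the zero space. *)
Lemma proj_diagonal_sphere gamma (e : R) (w : X) : e = 1 \/ e = -1 ->
  (C_ ip gamma !=set0 -> exists u : X, `|u| ^+ 2 = `|w| ^+ 2 / 2 - 2 * e * gamma) ->
  proj (C_ ip gamma) (w, e *: w) =
  [set (2^-1 *: w - e *: ((Num.sqrt 2)^-1 *: u),
        e *: (2^-1 *: w) + (Num.sqrt 2)^-1 *: u)
    | u in [set u : X | `|u| ^+ 2 = `|w| ^+ 2 / 2 - 2 * e * gamma]].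
Proof.
move=> e1 exu; have ee : e * e = 1 by case: e1 => ->; ring.
have half : 2^-1 *: w + 2^-1 *: w = w.
  by rewrite -scalerDl -[RHS]scale1r; congr (_ *: _); lra.
set c := (Num.sqrt 2)^-1; have cc : c * c = 2^-1.
  by rewrite -invfM -expr2 sqr_sqrtr.
have c0 : c != 0 by rewrite invr_eq0 sqrtr_eq0 -ltNge.
pose P (u : X) : X * X := (2^-1 *: w - e *: (c *: u), e *: (2^-1 *: w) + c *: u).
have CP u : C_ ip gamma (P u) <-> `|u| ^+ 2 = `|w| ^+ 2 / 2 - 2 * e * gamma.
  have ipP : ip (P u).1 (P u).2 = e * (`|w| ^+ 2 / 2 - `|u| ^+ 2) / 2.
    rewrite /P /= !normE !ip_linE (ipC u w).
    transitivity (e * (ip w w / 4 - (c * c) * ip u u)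
      + (1 - e * e) * c * ip w u / 2); first by field.
    by rewrite cc ee; field.
  by rewrite /C_ /= ipP; case: e1 => ->; split; lra.
have lineP u : (P u).1 + e *: (P u).2 = w.
  rewrite /P /= scalerDr addrACA [e *: (e *: _)]scalerA ee scale1r half.
  by rewrite addNr addr0.
have [[u0 /CP C0]|no] := pselect
    (exists u : X, `|u| ^+ 2 = `|w| ^+ 2 / 2 - 2 * e * gamma); last first.
  have C0 : ~ (C_ ip gamma !=set0) by move=> /exu.
  apply/seteqP; split=> z; first by case=> Cz _; case: C0; exists z.
  by case=> u /= uE _; case: no; exists u.
have := proj_diagonal e1 C0; rewrite lineP => ->.
apply/seteqP; split=> [[a b] [Cab abw]|_ [u /CP CPu <-]]; last first.
  by split=> //; apply: lineP.
rewrite /= in abw.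
have abP : P (c^-1 *: (b - e *: (2^-1 *: w))) = (a, b).
  rewrite /P scalerA mulfV // scale1r [_ + (b - _)]addrC subrK; congr (_, _).
  rewrite scalerBr scalerA ee scale1r opprB addrA half.
  by rewrite -abw addrK.
by exists (c^-1 *: (b - e *: (2^-1 *: w))) => //; apply/CP; rewrite abP.
Qed.

Lemma exists_norm_sqr (v : X) r : v != 0 -> 0 <= r -> exists u : X, `|u| ^+ 2 = r.
Proof.
move=> v0 r0; exists ((Num.sqrt r / `|v|) *: v).
rewrite normrZ exprMn normf_div !normr_id -exprMn divfK ?normr_eq0 //.
by rewrite ger0_norm ?sqrtr_ge0 // sqr_sqrtr.
Qed.

(** * Solving the critical point equations *)

(** The constraint at the critical point with multiplier [l], in terms of [H]. *)
Lemma ip_criticalE gamma (l : R) x0 y0 :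
  ip ((1 - l ^+ 2)^-1 *: (x0 - l *: y0)) ((1 - l ^+ 2)^-1 *: (y0 - l *: x0)) =
  H gamma (2 * ip x0 y0) (`|x0| ^+ 2 + `|y0| ^+ 2) l + gamma.
Proof.
rewrite /H !normE !ip_linE (ipC y0 x0) invfM -exprVn.
by set c := (1 - _)^-1; field.
Qed.

Lemma critical_pointK (l : R) (x0 y0 : X) : -1 < l < 1 ->
  (1 - l ^+ 2)^-1 *: (x0 - l *: y0)
    + l *: ((1 - l ^+ 2)^-1 *: (y0 - l *: x0)) = x0.
Proof.
move=> l1; have nz : 1 - l ^+ 2 != 0 by rewrite gt_eqF //; nra.
rewrite scalerA mulrC -scalerA -scalerDr scalerBr scalerA addrA subrK.
by rewrite -expr2 -{1}[x0]scale1r -scalerBl scalerA mulVf // scale1r.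
Qed.

(** Both [q + p = |x0 + y0|^2] and [q - p = |x0 - y0|^2] are positive. *)
Lemma norm_ip_lt x0 y0 : x0 <> y0 -> x0 <> - y0 ->
  `|2 * ip x0 y0| < `|x0| ^+ 2 + `|y0| ^+ 2.
Proof.
move=> xy xNy.
have A0 : 0 < ip (x0 + y0) (x0 + y0).
  by rewrite -normE exprn_gt0 // normr_gt0 addr_eq0; exact/eqP.
have B0 : 0 < ip (x0 - y0) (x0 - y0).
  by rewrite -normE exprn_gt0 // normr_gt0 subr_eq0; exact/eqP.
move: A0 B0; rewrite !normE !ip_linE (ipC y0 x0) ltr_norml {xy xNy} => A0 B0.
by apply/andP; split; lra.
Qed.

End InnerProduct.

(** * The projection formulas *)

Theorem theorem4p1 (R : realType) (X : completeNormedModType R)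
    (ip : {dot X for idfun}) (ip_norm : induces_norm ip)
    (gamma : R) (gamma_gt0 : 0 < gamma) (x0 y0 : X) :
  (* (i) *)
  (x0 <> y0 -> x0 <> - y0 ->
    let p := 2 * ip x0 y0 in
    let q := `|x0| ^+ 2 + `|y0| ^+ 2 in
    exists lambda : R,
      unique (fun l : R => -1 < l < 1 /\ H gamma p q l = 0) lambda /\
      proj (C_ ip gamma) (x0, y0) =
        [set ((1 - lambda ^+ 2)^-1 *: (x0 - lambda *: y0),
              (1 - lambda ^+ 2)^-1 *: (y0 - lambda *: x0))]) /\
  (* (ii) *)
  (x0 = - y0 ->
    proj (C_ ip gamma) (x0, - x0) =
      [set (2^-1 *: x0 + (Num.sqrt 2)^-1 *: u,
            - (2^-1 *: x0) + (Num.sqrt 2)^-1 *: u)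
        | u in [set u : X | `|u| ^+ 2 = 2 * gamma + `|x0| ^+ 2 / 2]]) /\
  (* (iii) a) *)
  (x0 = y0 -> 2 * Num.sqrt gamma <= `|x0| ->
    proj (C_ ip gamma) (x0, x0) =
      [set (2^-1 *: x0 - (Num.sqrt 2)^-1 *: v,
            2^-1 *: x0 + (Num.sqrt 2)^-1 *: v)
        | v in [set v : X | `|v| ^+ 2 = `|x0| ^+ 2 / 2 - 2 * gamma]]) /\
  (* (iii) b) *)
  (x0 = y0 -> 0 < `|x0| < 2 * Num.sqrt gamma ->
    proj (C_ ip gamma) (x0, x0) =
      [set Num.sqrt gamma *: (`|x0|^-1 *: x0, `|x0|^-1 *: x0)]).
Proof.
split; [|split; [|split]].
- move=> xy xNy p q.
  have [l [l1 Hl]] := exists_H_root gamma (norm_ip_lt ip_norm xy xNy).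
  pose a (m : R) := (1 - m ^+ 2)^-1 *: (x0 - m *: y0).
  pose b (m : R) := (1 - m ^+ 2)^-1 *: (y0 - m *: x0).
  have projE m : -1 < m < 1 -> H gamma p q m = 0 ->
      ip (a m) (b m) = gamma /\ proj (C_ ip gamma) (x0, y0) = [set (a m, b m)].
    move=> m1 Hm; have Cm : ip (a m) (b m) = gamma.
      by rewrite (ip_criticalE ip_norm gamma) Hm add0r.
    split=> //; rewrite -(proj_critical_lt1 ip_norm m1 Cm).
    by rewrite !critical_pointK.
  exists l; split; last by case: (projE l).
  split=> // m [m1 Hm].
  have [Cl El] := projE l l1 Hl; have [Cm Em] := projE m m1 Hm.
  have : [set (a l, b l)] (a m, b m) by rewrite -El Em.
  move=> [am bm]; apply/eqP; rewrite -subr_eq0.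
  (* Both multipliers satisfy [x0 = a + l b] for the same [(a, b)], and
     [b <> 0] because [<a, b> = gamma > 0]. *)
  have : (l - m) *: b l = 0.
    rewrite scalerBl -{2}bm; apply: (addrI (a l)).
    rewrite addr0 addrA critical_pointK // -am.
    by apply/eqP; rewrite subr_eq -[X in X == _](critical_pointK x0 y0 m1).
  move=> /eqP; rewrite scaler_eq0 => /orP[//|/eqP bl].
  by move: gamma_gt0; rewrite -Cl bl (linear0r ip) ltxx.
- move=> _; have exu : C_ ip gamma !=set0 ->
      exists u : X, `|u| ^+ 2 = `|x0| ^+ 2 / 2 - 2 * -1 * gamma.
    (* A point with [a + b = 0] would have [<a, b> <= 0 < gamma]. *)
    move=> [[a b] Cab]; apply: (@exists_norm_sqr _ _ (a + b)).
      apply/eqP => /eqP; rewrite addr_eq0 => /eqP ab.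
      move: gamma_gt0; rewrite -Cab /= ab (ipNl ip).
      by rewrite oppr_gt0 ltNge ip_ge0.
    by have := sqr_ge0 `|x0|; lra.
  have -> : - x0 = -1 *: x0 by rewrite scaleN1r.
  rewrite proj_diagonal_sphere //; last by right.
  by apply/seteqP; split=> z [u uE <-]; exists u; rewrite ?scaleN1r ?opprK //=;
    rewrite /= in uE; lra.
- move=> _ x0_ge.
  have s0 : 0 < Num.sqrt gamma by rewrite sqrtr_gt0.
  have ss : Num.sqrt gamma ^+ 2 = gamma by rewrite sqr_sqrtr // ltW.
  rewrite -{2}[x0]scale1r proj_diagonal_sphere //; [|by left|].
    by apply/seteqP; split=> z [u uE <-]; exists u; rewrite ?scale1r //=;
      rewrite /= in uE; lra.
  move=> _; apply: (@exists_norm_sqr _ _ x0).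
    by rewrite -normr_gt0; lra.
  by nra.
- move=> _ /andP[x0_gt0]; set s := Num.sqrt gamma => x0_lt.
  have s0 : 0 < s by rewrite sqrtr_gt0.
  have ss : s ^+ 2 = gamma by rewrite sqr_sqrtr // ltW.
  set b := s *: (`|x0|^-1 *: x0).
  (* The multiplier for which [b + l b = x0]. *)
  pose l := `|x0| / s - 1.
  have l1 : -1 < l < 1.
    have r0 : 0 < `|x0| / s by rewrite divr_gt0.
    have r2 : `|x0| / s < 2 by rewrite ltr_pdivrMr.
    by rewrite /l; lra.
  have Cb : ip b b = gamma.
    rewrite /b !(ipZl,ipZr) -normE //.
    by rewrite -ss; field; rewrite gt_eqF.
  have bx : b + l *: b = x0.
    rewrite -{1}[b]scale1r -scalerDl /l addrC subrK /b !scalerA.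
    by rewrite divfK ?gt_eqF // divff ?scale1r // gt_eqF.
  by have := proj_critical_lt1 ip_norm l1 Cb; rewrite bx.
Qed.
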